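(* Let $\mathbf A=\alpha\mathbf I+\mathbf S\in\mathbb R^{n\times n}$ be a shifted skew-symmetric matrix, i.e. $\alpha\in\mathbb R$, $\alpha\ne0$, $\mathbf S^\top=-\mathbf S$, and let $\mathbf b\in\mathbb R^n$ be nonzero. Let $\mathbf x_k^{\rm G}$ and $\mathbf x_k^{\rm CRAIG}$ be the $k$th iterates of S$^3$CG and CRAIG for $\mathbf A\mathbf x=\mathbf b$, respectively. Then for every $k\ge 1$ for which the CRAIG iterate is defined, $$\mathbf x_{2k}^{\rm G}=\mathbf x_k^{\rm CRAIG}.$$
   Context: Exact arithmetic and zero initial approximation are assumed. $\mathcal K_k(\mathbf A,\mathbf b)=\mathrm{span}\{\mathbf b,\mathbf A\mathbf b,\dots,\mathbf A^{k-1}\mathbf b\}$. The notation $\gamma\mathbf w:=\mathbf c$ means $\gamma=\|\mathbf c\|_2$; if $\gamma=0$ then stop, else $\mathbf w=\mathbf c/\gamma$. S$^3$CG: the iterate $\mathbf x_k^{\rm G}$ is determined by the Galerkin condition $\mathbf x_k^{\rm G}\in\mathcal K_k(\mathbf A,\mathbf b)$, $\mathbf b-\mathbf A\mathbf x_k^{\rm G}\perp\mathcal K_k(\mathbf A,\mathbf b)$; it exists and is unique for each $k\ge1$ (and equals $\mathbf A^{-1}\mathbf b$ once the Krylov subspaces have become stationary). CRAIG (based on Golub--Kahan bidiagonalization of $\mathbf A$ with starting vector $\mathbf b$): compute $\beta_1\mathbf u_1:=\mathbf b$, $\alpha_1\mathbf v_1:=\mathbf A^\top\mathbf u_1$, and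 for $j=1,2,\dots$: $\beta_{j+1}\mathbf u_{j+1}:=\mathbf A\mathbf v_j-\alpha_j\mathbf u_j$, $\alpha_{j+1}\mathbf v_{j+1}:=\mathbf A^\top\mathbf u_{j+1}-\beta_{j+1}\mathbf v_j$. Here the process stops with $\beta_{k_0+1}=0$ for some $k_0\le n$, and $\alpha_j,\beta_j>0$ for $1\le j\le k_0$. Let $\mathbf V_k=[\mathbf v_1\ \cdots\ \mathbf v_k]$ and let $\mathbf B_k\in\mathbb R^{k\times k}$ be the lower bidiagonal matrix with diagonal $\alpha_1,\dots,\alpha_k$ and subdiagonal $\beta_2,\dots,\beta_k$. For $1\le k\le k_0$ the CRAIG iterate is $\mathbf x_k^{\rm CRAIG}=\mathbf V_k\mathbf t_k$, where $\mathbf B_k\mathbf t_k=\beta_1\mathbf e_1$. *)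

(* Defs.v *)
From mathcomp Require Export all_boot all_order all_algebra.

Set Implicit Arguments.
Unset Strict Implicit.
Unset Printing Implicit Defensive.

Import Order.TTheory GRing.Theory Num.Theory.
Local Open Scope ring_scope.

Definition dotv (R : rcfType) (n : nat) (x y : 'cV[R]_n) : R :=
  \sum_(i < n) x i 0 * y i 0.

Definition norm2 (R : rcfType) (n : nat) (x : 'cV[R]_n) : R :=
  Num.sqrt (dotv x x).

Definition krylov (R : rcfType) (n : nat) (A : 'M[R]_n) (b : 'cV[R]_n)
    (k : nat) : {vspace 'cV[R]_n} :=
  <<mkseq (fun i => (A ^+ i) *m b) k>>%VS.

(* The S3CG iterate is determined by the Galerkin condition, so "x is the k-th
   iterate" is a property of x. *)
Definition is_s3cg_iterate (R : rcfType) (n : nat) (A : 'M[R]_n)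
    (b : 'cV[R]_n) (k : nat) (x : 'cV[R]_n) : Prop :=
  x \in krylov A b k /\
  forall y, y \in krylov A b k -> dotv (b - A *m x) y = 0.

Record gk_data (R : rcfType) (n : nat) := GKData {
  gk_beta : R;
  gk_u : 'cV[R]_n;
  gk_alpha : R;
  gk_v : 'cV[R]_n
}.

(* beta u := c;  alpha v := A^T u - beta v'.
   Since 0^-1 = 0, a vanishing beta or alpha yields u = 0 or v = 0 instead of
   stopping; the stopping test is in craig_defined. *)
Definition gk_step (R : rcfType) (n : nat) (A : 'M[R]_n) (c v' : 'cV[R]_n) :
    gk_data R n :=
  let beta := norm2 c in
  let u := beta^-1 *: c in
  let d := A^T *m u - beta *: v' in
  let alpha := norm2 d in
  GKData beta u alpha (alpha^-1 *: d).

(* golub_kahan A b j contains beta_(j+1), u_(j+1), alpha_(j+1), v_(j+1) of the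
   usual 1-based numbering; the first step is the general one with v_0 = 0. *)
Fixpoint golub_kahan (R : rcfType) (n : nat) (A : 'M[R]_n) (b : 'cV[R]_n)
    (j : nat) : gk_data R n :=
  if j is j'.+1 then
    let s := golub_kahan A b j' in
    gk_step A (A *m gk_v s - gk_alpha s *: gk_u s) (gk_v s)
  else gk_step A b 0.

(* The process has not stopped before completing step k, i.e. k <= k_0. *)
Definition craig_defined (R : rcfType) (n : nat) (A : 'M[R]_n)
    (b : 'cV[R]_n) (k : nat) : Prop :=
  forall j : nat, (j < k)%N ->
    0 < gk_beta (golub_kahan A b j) /\ 0 < gk_alpha (golub_kahan A b j).

Definition craig_V (R : rcfType) (n : nat) (A : 'M[R]_n) (b : 'cV[R]_n)
    (k : nat) : 'M[R]_(n, k) :=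
  \matrix_(i < n, j < k) gk_v (golub_kahan A b j) i 0.

(* Row i holds alpha_(i+1) on the diagonal and beta_(i+1) to its left. *)
Definition craig_B (R : rcfType) (n : nat) (A : 'M[R]_n) (b : 'cV[R]_n)
    (k : nat) : 'M[R]_k :=
  \matrix_(i < k, j < k)
    if i == j then gk_alpha (golub_kahan A b i)
    else if i == j.+1 :> nat then gk_beta (golub_kahan A b i)
    else 0.

Definition craig_rhs (R : rcfType) (n : nat) (A : 'M[R]_n) (b : 'cV[R]_n)
    (k : nat) : 'cV[R]_k :=
  \col_(i < k) if i == 0%N :> nat then gk_beta (golub_kahan A b 0) else 0.

(* Meaningful under craig_defined, where craig_B is invertible because it is
   triangular with positive diagonal. *)
Definition craig_iterate (R : rcfType) (n : nat) (A : 'M[R]_n) (b : 'cV[R]_n)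
    (k : nat) : 'cV[R]_n :=
  craig_V A b k *m (invmx (craig_B A b k) *m craig_rhs A b k).

(* Main.v *)
Require Import Defs.
From mathcomp Require Import all_boot all_order all_algebra.

Set Implicit Arguments.
Unset Strict Implicit.

Import Order.TTheory GRing.Theory Num.Theory.
Local Open Scope ring_scope.

(** Write u_j, v_j for the Golub-Kahan vectors.  Since A^T = 2 alpha I - A, the
    two Golub-Kahan recurrences say that multiplication by A sends each vector
    of the interlaced sequence u_1, v_1, u_2, v_2, ... into the span of itself,
    its predecessors and its successor; hence the first m interlaced vectors
    span the Krylov space K_m(A, b) ([krylov_gk_vec]).  In particular
    K_2k(A, b) = span(u_1, v_1, ..., u_k, v_k), and it contains the CRAIG
    iterate, a combination of v_1, ..., v_k.

    The bidiagonal relation shows that the CRAIG residual is a multiple of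
    u_(k+1) ([craig_residual]).  This vector is orthogonal to u_1, ..., u_k by
    the usual Golub-Kahan argument ([gk_orthogonal]).  It is also orthogonal to
    v_1, ..., v_k: these lie in the span of the A^T u_j = alpha u_j - S u_j, and
    <u_i, S u_j> = 0 for all i, j because u_i and u_j are polynomials in
    A A^T = alpha^2 I - S^2 applied to b, so that the form is b^T X b for a
    skew-symmetric X ([gk_u_skew]).  So the CRAIG iterate satisfies the Galerkin
    condition of order 2k.  That condition determines its solution because
    d^T A d = alpha d^T d ([galerkin_unique]). *)

(** * The inner product and spans *)

Lemma dotv0l (R : rcfType) (n : nat) (y : 'cV[R]_n) : dotv 0 y = 0.
Proof. by rewrite /dotv big1 // => i _; rewrite mxE mul0r. Qed.

Lemma dotvC (R : rcfType) (n : nat) (x y : 'cV[R]_n) : dotv x y = dotv y x.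
Proof. by apply: eq_bigr => i _; rewrite mulrC. Qed.

Lemma dotvDl (R : rcfType) (n : nat) (x y z : 'cV[R]_n) :
  dotv (x + y) z = dotv x z + dotv y z.
Proof. by rewrite /dotv -big_split; apply: eq_bigr => i _; rewrite mxE mulrDl. Qed.

Lemma dotvZl (R : rcfType) (n : nat) (a : R) (x z : 'cV[R]_n) :
  dotv (a *: x) z = a * dotv x z.
Proof. by rewrite /dotv big_distrr /=; apply: eq_bigr => i _; rewrite mxE mulrA. Qed.

Lemma dotvBl (R : rcfType) (n : nat) (x y z : 'cV[R]_n) :
  dotv (x - y) z = dotv x z - dotv y z.
Proof. by rewrite -scaleN1r dotvDl dotvZl mulN1r. Qed.

Lemma dotv0r (R : rcfType) (n : nat) (y : 'cV[R]_n) : dotv y 0 = 0.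
Proof. by rewrite dotvC dotv0l. Qed.

Lemma dotvDr (R : rcfType) (n : nat) (x y z : 'cV[R]_n) :
  dotv z (x + y) = dotv z x + dotv z y.
Proof. by rewrite !(dotvC z) dotvDl. Qed.

Lemma dotvZr (R : rcfType) (n : nat) (a : R) (x z : 'cV[R]_n) :
  dotv z (a *: x) = a * dotv z x.
Proof. by rewrite !(dotvC z) dotvZl. Qed.

Lemma dotv_lin2 (R : rcfType) (n : nat) (a c : R) (x y z : 'cV[R]_n) :
  dotv z (a *: x + c *: y) = a * dotv z x + c * dotv z y.
Proof. by rewrite dotvDr !dotvZr. Qed.

Lemma dotvE (R : rcfType) (n : nat) (x y : 'cV[R]_n) :
  dotv x y = (x^T *m y) 0 0.
Proof. by rewrite mxE; apply: eq_bigr => i _; rewrite mxE. Qed.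

Lemma dotv_mulmx (R : rcfType) (n : nat) (A : 'M[R]_n) (x y : 'cV[R]_n) :
  dotv (A *m x) y = dotv x (A^T *m y).
Proof. by rewrite !dotvE trmx_mul mulmxA. Qed.

(** Here 2 is invertible: <x, X x> equals its own opposite. *)
Lemma dotv_skew (R : rcfType) (n : nat) (X : 'M[R]_n) (x : 'cV[R]_n) :
  X^T = - X -> dotv x (X *m x) = 0.
Proof.
move=> hX; have : dotv x (X *m x) = - dotv x (X *m x).
  by rewrite {1}dotvC dotv_mulmx hX mulNmx -scaleN1r dotvZr mulN1r.
by move/eqP; rewrite -addr_eq0 -mulr2n mulrn_eq0 /= => /eqP.
Qed.

Lemma dotv_ge0 (R : rcfType) (n : nat) (x : 'cV[R]_n) : 0 <= dotv x x.
Proof. by apply: sumr_ge0 => i _; rewrite -expr2 sqr_ge0. Qed.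

Lemma dotv_eq0 (R : rcfType) (n : nat) (x : 'cV[R]_n) : dotv x x = 0 -> x = 0.
Proof.
move=> x0; apply/colP => i; rewrite mxE.
have /eqP := x0; rewrite psumr_eq0; last by move=> j _; rewrite -expr2 sqr_ge0.
by move/allP/(_ i (mem_index_enum _)); rewrite /= -expr2 sqrf_eq0 => /eqP.
Qed.

Lemma norm2_eq0 (R : rcfType) (n : nat) (x : 'cV[R]_n) : norm2 x = 0 -> x = 0.
Proof.
move/eqP; rewrite sqrtr_eq0 => x0; apply: dotv_eq0.
by apply/eqP; rewrite eq_le x0 dotv_ge0.
Qed.

Lemma norm2_normalize (R : rcfType) (n : nat) (c : 'cV[R]_n) :
  norm2 c *: ((norm2 c)^-1 *: c) = c.
Proof.
have [c0|c0] := eqVneq (norm2 c) 0; first by rewrite (norm2_eq0 c0) !scaler0.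
by rewrite scalerA divff // scale1r.
Qed.

Lemma dotv_normalize (R : rcfType) (n : nat) (c : 'cV[R]_n) : norm2 c != 0 ->
  dotv ((norm2 c)^-1 *: c) ((norm2 c)^-1 *: c) = 1.
Proof.
move=> c0; rewrite dotvZl dotvZr -[dotv c c]sqr_sqrtr ?dotv_ge0 //.
by rewrite -/(norm2 c) expr2 mulKf // mulVf.
Qed.

Lemma span_closed (K : fieldType) (vT : vectType K) (P : vT -> Prop)
    (s : seq vT) :
  P 0 -> (forall a x y, P x -> P y -> P (a *: x + y)) ->
  (forall x, x \in s -> P x) -> forall x, x \in <<s>>%VS -> P x.
Proof.
move=> P0 PD Ps x xs; rewrite (coord_span (X := in_tuple s) xs).
elim/big_ind: _ => // [y z Py Pz|i _].
  by rewrite -[y]scale1r; apply: PD.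
by rewrite -[_ *: _]addr0; apply: PD => //; apply/Ps/mem_nth.
Qed.

(** The span of the first [m] terms of a sequence of vectors; [krylov A b m] is
    the case [w i = A ^+ i *m b], by conversion. *)
Definition mspan (K : fieldType) (vT : vectType K) (w : nat -> vT) (m : nat) :
  {vspace vT} := <<mkseq w m>>%VS.

Lemma mspan_closed (K : fieldType) (vT : vectType K) (w : nat -> vT)
    (m : nat) (P : vT -> Prop) :
  P 0 -> (forall a x y, P x -> P y -> P (a *: x + y)) ->
  (forall i, (i < m)%N -> P (w i)) -> forall x, x \in mspan w m -> P x.
Proof.
move=> P0 PD Pw; apply: span_closed => // x /mapP [i].
by rewrite mem_iota /= => im ->; apply: Pw.
Qed.

Lemma mem_mspan (K : fieldType) (vT : vectType K) (w : nat -> vT) (m i : nat) :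
  (i < m)%N -> w i \in mspan w m.
Proof. by move=> im; apply/memv_span/mapP; exists i; rewrite ?mem_iota. Qed.

Lemma mspan_sub (K : fieldType) (vT : vectType K) (w : nat -> vT) (m p : nat) :
  (m <= p)%N -> {subset mspan w m <= mspan w p}.
Proof.
move=> mp x; apply: (mspan_closed (P := fun x => x \in _)) => [|a y z|i im].
- exact: mem0v.
- by move=> hy hz; rewrite memvD // memvZ.
- by apply: mem_mspan; apply: leq_trans mp.
Qed.

Lemma mulmx_mspan (R : rcfType) (n : nat) (A : 'M[R]_n) (w : nat -> 'cV[R]_n)
    (m : nat) (V : {vspace 'cV[R]_n}) :
  (forall i, (i < m)%N -> A *m w i \in V) ->
  forall x, x \in mspan w m -> A *m x \in V.
Proof.
move=> h; apply: mspan_closed => //; first by rewrite mulmx0 mem0v.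
by move=> a x y hx hy; rewrite mulmxDr -scalemxAr memvD // memvZ.
Qed.

(** * Golub-Kahan bidiagonalization *)

(* Indices start at 0: gku A b j, gkv A b j, gka A b j and gkb A b j are the
   vectors u_(j+1), v_(j+1) and the coefficients alpha_(j+1), beta_(j+1). *)
Notation gku A b j := (gk_u (golub_kahan A b j)).
Notation gkv A b j := (gk_v (golub_kahan A b j)).
Notation gka A b j := (gk_alpha (golub_kahan A b j)).
Notation gkb A b j := (gk_beta (golub_kahan A b j)).

(** The vector preceding [gkv A b j], which is subtracted in the recurrence for
    the latter; it is 0 for j = 0. *)
Definition gk_vprev (R : rcfType) (n : nat) (A : 'M[R]_n) (b : 'cV[R]_n)
    (j : nat) : 'cV[R]_n := if j is j'.+1 then gkv A b j' else 0.

(** The vector whose normalization is [gku A b j]. *)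
Definition gk_c (R : rcfType) (n : nat) (A : 'M[R]_n) (b : 'cV[R]_n)
    (j : nat) : 'cV[R]_n :=
  if j is j'.+1 then A *m gkv A b j' - gka A b j' *: gku A b j' else b.

Lemma golub_kahanE (R : rcfType) (n : nat) (A : 'M[R]_n) (b : 'cV[R]_n) j :
  golub_kahan A b j = gk_step A (gk_c A b j) (gk_vprev A b j).
Proof. by case: j. Qed.

Lemma gk_scale_u (R : rcfType) (n : nat) (A : 'M[R]_n) (b : 'cV[R]_n) j :
  gkb A b j *: gku A b j = gk_c A b j.
Proof. by rewrite golub_kahanE /= norm2_normalize. Qed.

Lemma gk_Av (R : rcfType) (n : nat) (A : 'M[R]_n) (b : 'cV[R]_n) j :
  A *m gkv A b j = gka A b j *: gku A b j + gkb A b j.+1 *: gku A b j.+1.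
Proof. by rewrite gk_scale_u /= addrC subrK. Qed.

Lemma gk_Atu (R : rcfType) (n : nat) (A : 'M[R]_n) (b : 'cV[R]_n) j :
  A^T *m gku A b j = gka A b j *: gkv A b j + gkb A b j *: gk_vprev A b j.
Proof. by rewrite golub_kahanE /= norm2_normalize subrK. Qed.

Lemma gk_u_eq0 (R : rcfType) (n : nat) (A : 'M[R]_n) (b : 'cV[R]_n) j :
  gkb A b j = 0 -> gku A b j = 0.
Proof. by rewrite golub_kahanE /= => ->; rewrite invr0 scale0r. Qed.

Lemma gk_v_eq0 (R : rcfType) (n : nat) (A : 'M[R]_n) (b : 'cV[R]_n) j :
  gka A b j = 0 -> gkv A b j = 0.
Proof. by rewrite golub_kahanE /= => ->; rewrite invr0 scale0r. Qed.

Lemma norm2_0 (R : rcfType) (n : nat) : norm2 (0 : 'cV[R]_n) = 0.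
Proof. by rewrite /norm2 dotv0l sqrtr0. Qed.

Lemma gk_alpha_eq0 (R : rcfType) (n : nat) (A : 'M[R]_n) (b : 'cV[R]_n) j :
  gkb A b j = 0 -> gka A b j = 0.
Proof.
rewrite golub_kahanE /= => ->.
by rewrite invr0 !scale0r mulmx0 subr0 norm2_0.
Qed.

Lemma gk_beta_eq0 (R : rcfType) (n : nat) (A : 'M[R]_n) (b : 'cV[R]_n) j :
  gka A b j = 0 -> gkb A b j.+1 = 0.
Proof.
move=> a0; rewrite golub_kahanE /= a0 gk_v_eq0 //.
by rewrite mulmx0 scale0r subr0 norm2_0.
Qed.

Lemma gk_u_unit (R : rcfType) (n : nat) (A : 'M[R]_n) (b : 'cV[R]_n) j :
  gkb A b j != 0 -> dotv (gku A b j) (gku A b j) = 1.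
Proof. by rewrite golub_kahanE /=; apply: dotv_normalize. Qed.

Lemma gk_v_unit (R : rcfType) (n : nat) (A : 'M[R]_n) (b : 'cV[R]_n) j :
  gka A b j != 0 -> dotv (gkv A b j) (gkv A b j) = 1.
Proof. by rewrite golub_kahanE /=; apply: dotv_normalize. Qed.

(** These identities replace the normalization |u_j| = |v_j| = 1 and remain
    true after a breakdown, when the vectors and coefficients all vanish. *)
Lemma gk_norms (R : rcfType) (n : nat) (A : 'M[R]_n) (b : 'cV[R]_n) j :
  [/\ gkb A b j * dotv (gku A b j) (gku A b j) = gkb A b j,
      gka A b j * dotv (gku A b j) (gku A b j) = gka A b j,
      gka A b j * dotv (gkv A b j) (gkv A b j) = gka A b j &
      gkb A b j.+1 * dotv (gkv A b j) (gkv A b j) = gkb A b j.+1].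
Proof.
have [b0|b0] := eqVneq (gkb A b j) 0; last rewrite (gk_u_unit b0).
  have a0 := gk_alpha_eq0 b0.
  by rewrite b0 a0 (gk_beta_eq0 a0) !mul0r.
have [a0|a0] := eqVneq (gka A b j) 0; last by rewrite gk_v_unit // !mulr1.
by rewrite a0 (gk_beta_eq0 a0) !mul0r mulr1.
Qed.

Lemma gk_orthogonal (R : rcfType) (n : nat) (A : 'M[R]_n) (b : 'cV[R]_n) m :
  forall i, (i < m)%N -> dotv (gku A b m) (gku A b i) = 0 /\
                         dotv (gkv A b m) (gkv A b i) = 0.
Proof.
elim: m => // m IH.
have hprev i : (i <= m)%N -> dotv (gkv A b m) (gk_vprev A b i) = 0.
  by case: i => [|i] im /=; [rewrite dotv0r | case: (IH i im)].
have [nb1 _ _ _] := gk_norms A b m.+1.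
have [_ na1 na2 nb2] := gk_norms A b m.
have hu i : (i <= m)%N -> dotv (gku A b m.+1) (gku A b i) = 0.
  move=> im; have [/gk_u_eq0 ->|b0] := eqVneq (gkb A b m.+1) 0.
    by rewrite dotv0l.
  apply: (mulfI b0); rewrite mulr0 -dotvZl gk_scale_u /= dotvBl dotv_mulmx.
  rewrite gk_Atu dotv_lin2 dotvZl hprev // mulr0 addr0.
  have [-> //|im'] := eqVneq i m; first by rewrite na1 na2 subrr.
  have [|-> ->] := IH i; first by rewrite ltn_neqAle im'.
  by rewrite !mulr0 subrr.
move=> i im; split; first exact: hu.
have [/gk_v_eq0 ->|a0] := eqVneq (gka A b m.+1) 0; first by rewrite dotv0l.
apply: (mulfI a0); rewrite mulr0 -dotvZl.
have -> : gka A b m.+1 *: gkv A b m.+1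
        = A^T *m gku A b m.+1 - gkb A b m.+1 *: gkv A b m.
  by rewrite gk_Atu addrK.
rewrite dotvBl (dotvZl _ (gkv A b m)) dotv_mulmx trmxK gk_Av dotv_lin2.
rewrite (hu i) // mulr0 add0r.
have [->|im'] := eqVneq i m; first by rewrite nb1 nb2 subrr.
have im1 : (i < m)%N by rewrite ltn_neqAle im'.
by rewrite (hu i.+1) // (proj2 (IH i im1)) !mulr0 subrr.
Qed.

(** * Skew-symmetry *)

(** [sym_bicomm M P] stands for: P is a polynomial in the symmetric matrix M.
    It records the two consequences of this that matter: P is symmetric, and it
    commutes with every matrix that commutes with M. *)
Definition sym_bicomm (R : rcfType) (n : nat) (M P : 'M[R]_n) : Prop :=
  P^T = P /\ forall X : 'M[R]_n, M *m X = X *m M -> P *m X = X *m P.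

Lemma sym_bicomm1 (R : rcfType) (n : nat) (M : 'M[R]_n) :
  sym_bicomm M 1%:M.
Proof. by split=> [|X _]; rewrite ?trmx1 // mul1mx mulmx1. Qed.

Lemma sym_bicomm_lin (R : rcfType) (n : nat) (M P Q : 'M[R]_n) (a : R) :
  sym_bicomm M P -> sym_bicomm M Q -> sym_bicomm M (a *: P + Q).
Proof.
move=> [sP cP] [sQ cQ]; split=> [|X hX]; first by rewrite linearP /= sP sQ.
by rewrite mulmxDl mulmxDr -scalemxAl -scalemxAr cP // cQ.
Qed.

Lemma sym_bicommM (R : rcfType) (n : nat) (M P : 'M[R]_n) :
  M^T = M -> sym_bicomm M P -> sym_bicomm M (M *m P).
Proof.
move=> sM [sP cP]; split=> [|X hX]; first by rewrite trmx_mul sP sM cP.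
by rewrite -mulmxA cP // !mulmxA hX.
Qed.

(** Each u is p(A A^T) b and each v is A^T q(A A^T) b, for polynomials p, q. *)
Lemma gk_sym_bicomm (R : rcfType) (n : nat) (A : 'M[R]_n) (b : 'cV[R]_n) j :
  (exists2 P, sym_bicomm (A *m A^T) P & gku A b j = P *m b) /\
  (exists2 Q, sym_bicomm (A *m A^T) Q & gkv A b j = A^T *m (Q *m b)).
Proof.
set M := A *m A^T.
have sM : M^T = M by rewrite trmx_mul trmxK.
have h0 : sym_bicomm M 0.
  by split=> [|X _]; rewrite ?trmx0 // mul0mx mulmx0.
have hZ a P : sym_bicomm M P -> sym_bicomm M (a *: P).
  by move=> hP; rewrite -[_ *: _]addr0; apply: sym_bicomm_lin.
have hv m : (exists2 P, sym_bicomm M P & gku A b m = P *m b) ->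
    (exists2 Q, sym_bicomm M Q & gk_vprev A b m = A^T *m (Q *m b)) ->
    exists2 Q, sym_bicomm M Q & gkv A b m = A^T *m (Q *m b).
  move=> [P hP eP] [Q hQ eQ].
  exists ((gka A b m)^-1 *: ((- gkb A b m) *: Q + P)).
    by apply/hZ/sym_bicomm_lin.
  have [a0|a0] := eqVneq (gka A b m) 0.
    by rewrite gk_v_eq0 // a0 invr0 scale0r mul0mx mulmx0.
  apply: (scalerI a0).
  have -> : gka A b m *: gkv A b m
          = A^T *m gku A b m - gkb A b m *: gk_vprev A b m.
    by rewrite gk_Atu addrK.
  rewrite -scalemxAl -scalemxAr scalerA divff // scale1r mulmxDl mulmxDr.
  by rewrite -scalemxAl -scalemxAr eP eQ addrC scaleNr.
have hu m c : (exists2 P, sym_bicomm M P & c = P *m b) ->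
    gk_c A b m = c -> exists2 P, sym_bicomm M P & gku A b m = P *m b.
  move=> [P hP ->] ec; exists ((gkb A b m)^-1 *: P); first exact: hZ.
  by rewrite -scalemxAl -ec golub_kahanE.
elim: j => [|j [[P hP eP] [Q hQ eQ]]].
  have h : exists2 P, sym_bicomm M P & gku A b 0 = P *m b.
    apply: (hu 0%N b) => //; exists 1%:M; last by rewrite mul1mx.
    exact: sym_bicomm1.
  split=> //; apply: hv => //; exists 0 => //.
  by rewrite /= mul0mx mulmx0.
have h : exists2 P, sym_bicomm M P & gku A b j.+1 = P *m b.
  apply: hu (erefl _).
  exists ((- gka A b j) *: P + M *m Q).
    by apply/sym_bicomm_lin/sym_bicommM.
  by rewrite mulmxDl -scalemxAl -eP -mulmxA /= eQ !mulmxA scaleNr addrC.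
by split=> //; apply: hv => //; exists Q.
Qed.

Lemma gk_u_skew (R : rcfType) (n : nat) (alpha : R) (S A : 'M[R]_n)
    (b : 'cV[R]_n) (i j : nat) :
  S^T = - S -> A = alpha%:M + S -> dotv (gku A b i) (S *m gku A b j) = 0.
Proof.
move=> hS hA.
have hAt : A^T = alpha%:M - S by rewrite hA linearD /= tr_scalar_mx hS.
have [[P [sP cP] ->] _] := gk_sym_bicomm A b i.
have [[Q [sQ cQ] ->] _] := gk_sym_bicomm A b j.
have hMS : A *m A^T *m S = S *m (A *m A^T).
  have AS : A *m S = S *m A.
    by rewrite hA mulmxDl mulmxDr scalar_mxC.
  have AtS : A^T *m S = S *m A^T.
    by rewrite hAt mulmxBl mulmxBr scalar_mxC.
  by rewrite -mulmxA AtS !mulmxA AS.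
have PQ : P *m Q = Q *m P by rewrite cP // cQ.
rewrite dotv_mulmx sP !mulmxA; apply: dotv_skew.
(* S commutes with A A^T, hence with P and Q, and P commutes with Q. *)
rewrite !trmx_mul sP sQ hS mulNmx mulmxN; congr (- _).
by rewrite mulmxA (cQ _ hMS) -(mulmxA S) -PQ mulmxA -(cP _ hMS).
Qed.

(** By induction on j, from <u_k, A^T u_j> = alpha <u_k, u_j> - <u_k, S u_j> = 0
    and the expression of A^T u_j in terms of v_j and its predecessor. *)
Lemma gk_uv_orthogonal (R : rcfType) (n : nat) (alpha : R) (S A : 'M[R]_n)
    (b : 'cV[R]_n) (k j : nat) :
  S^T = - S -> A = alpha%:M + S -> (j < k)%N ->
  dotv (gku A b k) (gkv A b j) = 0.
Proof.
move=> hS hA.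
have hAt : A^T = alpha%:M - S by rewrite hA linearD /= tr_scalar_mx hS.
have hu i : (i < k)%N -> dotv (gku A b k) (A^T *m gku A b i) = 0.
  move=> ik; rewrite hAt mulmxBl mul_scalar_mx dotvDr dotvZr -scaleN1r dotvZr.
  by rewrite (gk_u_skew _ _ _ hS hA) (proj1 (gk_orthogonal A b ik)) !mulr0 addr0.
have hv i : (i < k)%N -> dotv (gku A b k) (gk_vprev A b i) = 0 ->
    dotv (gku A b k) (gkv A b i) = 0.
  move=> ik hprev; have [/gk_v_eq0 ->|a0] := eqVneq (gka A b i) 0.
    by rewrite dotv0r.
  by apply: (mulfI a0); rewrite mulr0 -(hu _ ik) gk_Atu dotv_lin2 hprev mulr0 addr0.
elim: j => [|j IH] jk; apply: hv => //=; first exact: dotv0r.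
exact/IH/ltnW.
Qed.

(** * The Krylov spaces of a shifted skew-symmetric matrix *)

(** The interlaced sequence u_1, v_1, u_2, v_2, ... *)
Definition gk_vec (R : rcfType) (n : nat) (A : 'M[R]_n) (b : 'cV[R]_n)
    (m : nat) : 'cV[R]_n := if odd m then gkv A b m./2 else gku A b m./2.

Lemma gk_vec_even (R : rcfType) (n : nat) (A : 'M[R]_n) (b : 'cV[R]_n) j :
  gk_vec A b j.*2 = gku A b j.
Proof. by rewrite /gk_vec odd_double doubleK. Qed.

Lemma gk_vec_odd (R : rcfType) (n : nat) (A : 'M[R]_n) (b : 'cV[R]_n) j :
  gk_vec A b j.*2.+1 = gkv A b j.
Proof. by rewrite /gk_vec /= odd_double uphalf_double. Qed.

(** Multiplication by A advances by one step in the interlaced sequence.  The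
    condition on [d] allows the next vector to be recovered from the image even
    after a breakdown, when it vanishes. *)
Lemma gk_vec_mulA (R : rcfType) (n : nat) (c : R) (A : 'M[R]_n)
    (b : 'cV[R]_n) (m : nat) : A^T = c%:M - A ->
  exists2 d, d = 0 -> gk_vec A b m.+1 = 0 &
    A *m gk_vec A b m - d *: gk_vec A b m.+1 \in mspan (gk_vec A b) m.+1.
Proof.
move=> hA; rewrite -(odd_double_half m); set j := m./2.
case: (odd m); rewrite ?add0n ?add1n.
  rewrite -doubleS gk_vec_even gk_vec_odd; exists (gkb A b j.+1).
    exact: gk_u_eq0.
  by rewrite gk_Av addrK memvZ // -gk_vec_even mem_mspan // doubleS.
rewrite gk_vec_even gk_vec_odd; exists (- gka A b j).
  by move/eqP; rewrite oppr_eq0 => /eqP; apply: gk_v_eq0.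
have -> : A *m gku A b j = c *: gku A b j - A^T *m gku A b j.
  by rewrite hA mulmxBl mul_scalar_mx opprB addrC subrK.
rewrite gk_Atu scaleNr opprK [gka A b j *: _ + _]addrC opprD addrA subrK.
rewrite memvB // memvZ //; first by rewrite -gk_vec_even mem_mspan.
case: j => [|j] /=; first exact: mem0v.
by rewrite -gk_vec_odd mem_mspan // doubleS; apply: leqnSn.
Qed.

(** This needs no assumption on breakdowns: when the process has stopped, the
    Krylov spaces are stationary and the further vectors are zero. *)
Lemma krylov_gk_vec (R : rcfType) (n : nat) (c : R) (A : 'M[R]_n)
    (b : 'cV[R]_n) (m : nat) : A^T = c%:M - A ->
  krylov A b m =i mspan (gk_vec A b) m.
Proof.
move=> hA.
have AW p x : x \in mspan (gk_vec A b) p ->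
    A *m x \in mspan (gk_vec A b) p.+1.
  apply: mulmx_mspan => i ip.
  have [d _ hd] := gk_vec_mulA b i hA.
  rewrite -[A *m _](subrK (d *: gk_vec A b i.+1)); apply: memvD.
    by apply: mspan_sub hd; apply: ltnW.
  by rewrite memvZ // mem_mspan.
have AK p x : x \in krylov A b p -> A *m x \in krylov A b p.+1.
  apply: (mulmx_mspan (w := fun i => A ^+ i *m b)) => i ip.
  have -> : A *m (A ^+ i *m b) = A ^+ i.+1 *m b by rewrite exprS mulmxA.
  by apply: (mem_mspan (fun i => A ^+ i *m b)).
have b0 : b = gkb A b 0 *: gk_vec A b 0 by rewrite gk_scale_u.
have h1 p : A ^+ p *m b \in mspan (gk_vec A b) p.+1.
  elim: p => [|p IH]; last by rewrite exprS -mulmxA; apply: AW.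
  by rewrite expr0 mul1mx {1}b0 memvZ // mem_mspan.
have h2 p : gk_vec A b p \in krylov A b p.+1.
  elim/ltn_ind: p => -[|p] IH.
    have -> : gk_vec A b 0 = (norm2 b)^-1 *: (A ^+ 0 *m b).
      by rewrite expr0 mul1mx.
    by rewrite memvZ // (mem_mspan (fun i => A ^+ i *m b)).
  have [d d0 hd] := gk_vec_mulA b p hA.
  have [/d0 ->|dn0] := eqVneq d 0; first exact: mem0v.
  have -> : gk_vec A b p.+1 = d^-1 *: (A *m gk_vec A b p
      - (A *m gk_vec A b p - d *: gk_vec A b p.+1)).
    by rewrite subKr scalerA mulVf // scale1r.
  rewrite memvZ // memvB ?AK ?IH //.
  move: hd; apply: (mspan_closed (P := fun x => x \in krylov A b p.+2)).
  - exact: mem0v.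
  - by move=> a y z hy hz; rewrite memvD // memvZ.
  - move=> i ip; apply: (mspan_sub (w := fun i => A ^+ i *m b)) (IH i ip).
    exact: ltnW.
move=> x; apply/idP/idP.
- apply: (mspan_closed (P := fun x => x \in mspan (gk_vec A b) m)).
  + exact: mem0v.
  + by move=> a y z hy hz; rewrite memvD // memvZ.
  + by move=> i im; apply: mspan_sub (h1 i).
- apply: (mspan_closed (P := fun x => x \in krylov A b m)).
  + exact: mem0v.
  + by move=> a y z hy hz; rewrite memvD // memvZ.
  + by move=> i im; apply: (mspan_sub (w := fun i => A ^+ i *m b)) (h2 i).
Qed.

(** * The Galerkin condition *)

(** The difference d of two solutions lies in the Krylov space and A d is
    orthogonal to it, so that 0 = <d, A d> = alpha <d, d>. *)
Lemma galerkin_unique (R : rcfType) (n : nat) (alpha : R) (S A : 'M[R]_n)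
    (b : 'cV[R]_n) (m : nat) (x y : 'cV[R]_n) :
  alpha != 0 -> S^T = - S -> A = alpha%:M + S ->
  is_s3cg_iterate A b m x -> is_s3cg_iterate A b m y -> x = y.
Proof.
move=> halpha hS hA [xK hx] [yK hy]; apply/eqP; rewrite -subr_eq0; apply/eqP.
have dK : x - y \in krylov A b m by rewrite memvB.
apply: dotv_eq0; apply: (mulfI halpha); rewrite mulr0.
have : dotv (x - y) (A *m (x - y)) = 0.
  have -> : A *m (x - y) = (b - A *m y) - (b - A *m x).
    by rewrite mulmxBr opprB [RHS]addrC addrA subrK.
  by rewrite dotvC dotvBl hx // hy // subrr.
by rewrite hA mulmxDl dotvDr mul_scalar_mx dotvZr dotv_skew // addr0.
Qed.

(** * The CRAIG iterates *)

Lemma craig_B_unit (R : rcfType) (n : nat) (A : 'M[R]_n) (b : 'cV[R]_n) k :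
  craig_defined A b k -> craig_B A b k \in unitmx.
Proof.
move=> hdef; rewrite unitmxE det_trig; last first.
  apply/is_trig_mxP => i j ij; rewrite mxE.
  by rewrite -val_eqE /= !ltn_eqF // ltnW.
rewrite unitfE; apply/prodf_neq0 => i _; rewrite mxE eqxx.
by rewrite gt_eqF //; case: (hdef i).
Qed.

(** The last column of the product misses the term containing [u k]. *)
Lemma mulmx_bidiagonal (R : rcfType) (n k : nat) (u : nat -> 'cV[R]_n)
    (a c : nat -> R) :
  (\matrix_(l < n, j < k) u j l 0) *m
    (\matrix_(i < k, j < k)
       if i == j then a i else if i == j.+1 :> nat then c i else 0)
    + u k *m \row_(j < k) (if j.+1 == k then c k else 0) =
  \matrix_(l < n, j < k) (a j *: u j + c j.+1 *: u j.+1) l 0.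
Proof.
apply/matrixP => l j.
rewrite mxE [X in _ + X]mxE big_ord1 !mxE.
rewrite (bigD1 j) //= !mxE eqxx mulrC -addrA; congr (_ + _).
have [jk|jk] := eqVneq j.+1 k.
  rewrite big1 ?add0r ?jk 1?mulrC // => i ij.
  have ij1 : (i == j.+1 :> nat) = false by rewrite jk ltn_eqF.
  by rewrite !mxE (negPf ij) ij1 mulr0.
have jk1 : (j.+1 < k)%N by rewrite ltn_neqAle jk ltn_ord.
have ji : Ordinal jk1 != j by rewrite -val_eqE /= gtn_eqF.
rewrite mulr0 addr0 (bigD1 (Ordinal jk1)) //= !mxE (negPf ji) eqxx mulrC.
rewrite big1 ?addr0 // => i /andP [ij]; rewrite -val_eqE /= => ij1.
by rewrite !mxE (negPf ij) (negPf ij1) mulr0.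
Qed.

(** The bidiagonal relation A V_k = U_k B_k + beta_(k+1) u_(k+1) e_k^T. *)
Lemma craig_bidiagonal (R : rcfType) (n : nat) (A : 'M[R]_n) (b : 'cV[R]_n) k :
  A *m craig_V A b k =
    (\matrix_(l < n, j < k) gku A b j l 0) *m craig_B A b k
    + gku A b k *m \row_(j < k) (if j.+1 == k then gkb A b k else 0).
Proof.
rewrite (mulmx_bidiagonal k (fun j => gku A b j) (fun j => gka A b j)
           (fun j => gkb A b j)).
apply/matrixP => l j; rewrite [RHS]mxE -gk_Av !mxE.
by apply: eq_bigr => i _; rewrite mxE.
Qed.

Lemma craig_residual (R : rcfType) (n : nat) (A : 'M[R]_n) (b : 'cV[R]_n) k :
  (1 <= k)%N -> craig_defined A b k ->
  exists d, b - A *m craig_iterate A b k = d *: gku A b k.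
Proof.
move=> hk hdef; rewrite /craig_iterate; set t := invmx _ *m _.
have Bt : craig_B A b k *m t = craig_rhs A b k.
  by rewrite mulKVmx // craig_B_unit.
have Urhs : (\matrix_(l < n, j < k) gku A b j l 0) *m craig_rhs A b k = b.
  case: k hk {hdef t Bt} => // k _; apply/colP => l.
  rewrite mxE big_ord_recl big1 => [|i _]; last by rewrite !mxE mulr0.
  have e : gkb A b 0 *: gku A b 0 = b := gk_scale_u A b 0.
  have <- : (gkb A b 0 *: gku A b 0) l 0 = b l 0 by rewrite e.
  by rewrite addr0 [RHS]mxE mulrC; congr (_ * _); rewrite mxE.
rewrite mulmxA craig_bidiagonal mulmxDl -!mulmxA Bt Urhs opprD addrA subrr add0r.
set s := _ *m t; exists (- s 0 0).
by rewrite scaleNr [s in LHS]mx11_scalar mul_mx_scalar.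
Qed.

Unset Implicit Arguments.

Theorem theorem7 (R : rcfType) (n : nat) (alpha : R) (S A : 'M[R]_n)
    (b : 'cV[R]_n) (k : nat)
    (halpha : alpha != 0) (hS : S^T = - S) (hA : A = alpha%:M + S)
    (hb : b != 0) (hk : (1 <= k)%N) (hdef : craig_defined A b k) :
  forall x : 'cV[R]_n,
    is_s3cg_iterate A b (2 * k) x <-> x = craig_iterate A b k.
Proof.
have hAt : A^T = (alpha *+ 2)%:M - A.
  rewrite hA linearD /= tr_scalar_mx hS mulr2n.
  by rewrite [(alpha + _)%:M]raddfD /= opprD addrA addrK.
suff hx : is_s3cg_iterate A b (2 * k) (craig_iterate A b k).
  by move=> x; split=> [h|-> //]; exact: galerkin_unique halpha hS hA h hx.
split.
- rewrite (krylov_gk_vec _ _ hAt) /craig_iterate; set t := invmx _ *m _.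
  have -> : craig_V A b k *m t = \sum_(j < k) t j 0 *: gk_vec A b j.*2.+1.
    apply/colP => l; rewrite mxE summxE; apply: eq_bigr => j _.
    by rewrite !mxE gk_vec_odd mulrC.
  apply: memv_suml => j _; rewrite memvZ // mem_mspan //.
  by rewrite mul2n -doubleS leq_double.
- have [d ->] := craig_residual hk hdef.
  move=> y; rewrite (krylov_gk_vec _ _ hAt).
  apply: (mspan_closed (P := fun y => dotv (d *: gku A b k) y = 0)).
  + exact: dotv0r.
  + by move=> a {}y z hy hz; rewrite dotvDr dotvZr hy hz mulr0 addr0.
  move=> i ik.
  have ik2 : (i./2 < k)%N by rewrite ltn_half_double -mul2n.
  rewrite dotvZl /gk_vec; case: (odd i).
    by rewrite (gk_uv_orthogonal _ hS hA ik2) mulr0.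
  by rewrite (proj1 (gk_orthogonal A b ik2)) mulr0.
Qed.
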